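(* Let $\mathcal{A}\subset\mathbb{R}^d$ be a finite set of exponents that affinely spans $\mathbb{R}^d$. Suppose that $|\mathcal{T}|\subset\Delta^{\mathcal{A}}$ is the geometric realization of a triangulation $\mathcal{T}$ of $\mathcal{A}$ and that there is a weight $w\in\mathbb{R}^{\mathcal{A}}_>$ such that the distance between $X_{\mathcal{A},w}$ and $|\mathcal{T}|$ is less than $\frac{1}{2(d+1)}$. Then $\mathcal{T}$ is the regular triangulation of $\mathcal{A}$ induced by the lifting function $\lambda(\mathbf a)=\log(w_{\mathbf a})$, $\mathbf a\in\mathcal{A}$.
   Context: $\mathbb{R}^{\mathcal{A}}$ is the real vector space with basis $\{e_{\mathbf a}\mid\mathbf a\in\mathcal{A}\}$ and the Euclidean norm; $\mathbb{R}^{\mathcal{A}}_\ge$ and $\mathbb{R}^{\mathcal{A}}_>$ are its points with non-negative, respectively strictly positive, coordinates. $\Delta^{\mathcal{A}}=\{z\in\mathbb{R}^{\mathcal{A}}_\ge\mid\sum_{\mathbf a}z_{\mathbf a}=1\}$ is the $\mathcal{A}$-simplex. For $z\in\mathbb{R}^{\mathcal{A}}_\ge\setminus\{0\}$ write $[z_{\mathbf a}\mid\mathbf a\in\mathcal{A}]=\frac{1}{\sum_{\mathbf a} z_{\mathbf a}}(z_{\mathbf a}\mid\mathbf a\in\mathcal{A})\in\Delta^{\mathcal{A}}$. $X_{\mathcal{A}}\subset\Delta^{\mathcal{A}}$ is the closure of the image of $\varphi_{\mathcal{A}}\colon\mathbb{R}^d_>\to\Delta^{\mathcal{A}}$, $\varphi_{\mathcal{A}}(x)=[x^{\mathbf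 a}\mid\mathbf a\in\mathcal{A}]$, where $x^{\mathbf a}=x_1^{a_1}\cdots x_d^{a_d}$. For $w\in\mathbb{R}^{\mathcal{A}}_>$, $X_{\mathcal{A},w}=w.X_{\mathcal{A}}$ where $w.z=[w_{\mathbf a}z_{\mathbf a}\mid\mathbf a\in\mathcal{A}]$. A triangulation $\mathcal{T}=\{\mathcal{A}_i\mid i=1,\dots,m\}$ of $\mathcal{A}$ is a collection of $(d+1)$-element subsets of $\mathcal{A}$, each spanning a $d$-dimensional simplex, such that these simplices cover the convex hull of $\mathcal{A}$ and any two with non-empty intersection meet along a common face (not every point of $\mathcal{A}$ needs to belong to some $\mathcal{A}_i$). Its geometric realization is $|\mathcal{T}|=\bigcup_i\mathrm{conv}\{e_{\mathbf a}\mid\mathbf a\in\mathcal{A}_i\}\subset\Delta^{\mathcal{A}}$. Two subsets $X,Y$ of Euclidean space are within a distance $\epsilon$ if for every point $x$ of $X$ there is some point $y$ of $Y$ within a distance $\epsilon$ of $x$, and vice versa; the distance between $X$ and $Y$ is understood in this (Hausdorff) sense. Regular triangulation: for a lifting function $\lambda\colon\mathcal{A}\to\mathbb{R}$ let $P_\lambda\subset\mathbb{R}^{d+1}$ be the convex hull of the lifted points $\{(\mathbf a,\lambda(\mathbf a))\mid\mathbf a\in\mathcal{A}\}$; throughout, $P_\lambda$ is assumed to be full-dimensional (its affine span is $\mathbb{R}^{d+1}$). The upper facets of $P_\lambda$ are the facets whose outward-pointing normal vector has positive last coordinate. When $\lambda$ is generic, in that all upper facets are simplices and, for each upper facet, the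 set of $\mathbf a\in\mathcal{A}$ whose lifted point lies on that facet has exactly $d+1$ elements, the collection of these $(d+1)$-element subsets, one per upper facet, is the regular triangulation of $\mathcal{A}$ induced by $\lambda$. The conclusion that $\mathcal{T}$ is the regular triangulation induced by $\lambda$ includes that $\lambda$ is generic in this sense. *)

(* Defs.v *)
From HB Require Import structures.
From mathcomp Require Import all_boot all_order all_algebra.
From mathcomp Require Import finmap.
From mathcomp Require Import all_classical all_reals all_analysis.
Set Implicit Arguments.
Unset Strict Implicit.
Unset Printing Implicit Defensive.
Import Order.TTheory GRing.Theory Num.Theory numFieldNormedType.Exports.
(* [A -> R] carries the product topology, which for the finite type [A] is the
   Euclidean topology of R^A. *)
Import ArrowAsProduct.
Local Open Scope classical_set_scope.
Local Open Scope ring_scope.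

Section Convex.
Variables (R : realType) (V : lmodType R).

Definition affine_hull (S : set V) : set V :=
  [set p | exists n (x : 'I_n -> V) (c : 'I_n -> R),
    [/\ forall i, S (x i), \sum_i c i = 1 & p = \sum_i c i *: x i]].

Definition convex_hull (S : set V) : set V :=
  [set p | exists n (x : 'I_n -> V) (c : 'I_n -> R),
    [/\ forall i, S (x i), forall i, 0 <= c i, \sum_i c i = 1
      & p = \sum_i c i *: x i]].

End Convex.

Section Polytopes.
Variables (R : realType) (n : nat).
Local Notation V := 'rV[R]_n.
Implicit Types (P F : set V) (B : {fset V}).

Definition dot (u v : V) : R := \sum_i u 0 i * v 0 i.

Definition affine_dim (S : set V) (k : nat) : Prop :=
  exists (p : V) (U : {vspace V}),
    \dim U = k /\ affine_hull S = [set q | q - p \in U].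

(* [u] is a (not necessarily nonzero) outward normal vector of [P] along [F]. *)
Definition outward_normal P F (u : V) : Prop :=
  exists c : R,
    (forall p, P p -> dot u p <= c) /\ F = P `&` [set p | dot u p = c].

(* As [u = 0] is allowed, [P] itself and the empty set are faces of [P]. *)
Definition face P F : Prop := exists u, outward_normal P F u.

Definition facet P F : Prop :=
  face P F /\ exists k, affine_dim P k.+1 /\ affine_dim F k.

Definition spans_simplex (k : nat) B : Prop :=
  #|` B| = k.+1 /\ affine_dim [set` B] k.

Definition is_simplex (k : nat) F : Prop :=
  exists2 B, spans_simplex k B & F = convex_hull [set` B].

End Polytopes.

Section Toric.
Variables (R : realType) (d : nat).
Implicit Types (A B C : {fset 'rV[R]_d}) (T : {fset {fset 'rV[R]_d}}).

Definition normalize A (z : A -> R) : A -> R :=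
  fun a => (\sum_b z b)^-1 * z a.

Definition monomial (x a : 'rV[R]_d) : R := \prod_i x 0 i `^ a 0 i.

Definition toric_map A (x : 'rV[R]_d) : A -> R :=
  normalize (fun a : A => monomial x (val a)).

(* The ambient simplex is closed in R^A, so that the closure may be taken
   in R^A. *)
Definition toric_variety A : set (A -> R) :=
  closure (@toric_map A @` [set x : 'rV[R]_d | forall i, 0 < x 0 i]).

Definition weight_act A (w z : A -> R) : A -> R :=
  normalize (fun a => w a * z a).

Definition toric_translate A (w : A -> R) : set (A -> R) :=
  weight_act w @` @toric_variety A.

Definition basis_vector A (a : A) : A -> R := fun b => (b == a)%:R.

Definition triangulation A T : Prop :=
  [/\ forall B, B \in T -> (B `<=` A)%fset /\ spans_simplex d B,
      \bigcup_(B in [set` T]) convex_hull [set` B] = convex_hull [set` A]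
    & forall B C, B \in T -> C \in T ->
        let I := convex_hull [set` B] `&` convex_hull [set` C] in
        I !=set0 ->
        face (convex_hull [set` B]) I /\ face (convex_hull [set` C]) I].

Definition realization A T : set (A -> R) :=
  \bigcup_(B in [set` T])
    convex_hull (@basis_vector A @` [set a : A | val a \in B]).

Definition euclidean_norm A (z : A -> R) : R :=
  Num.sqrt (\sum_a z a ^+ 2).

Definition within_distance A (X Y : set (A -> R)) (e : R) : Prop :=
  (forall x, X x -> exists2 y, Y y & euclidean_norm (x - y) <= e) /\
  (forall y, Y y -> exists2 x, X x & euclidean_norm (x - y) <= e).

Definition hausdorff_distance A (X Y : set (A -> R)) : \bar R :=
  ereal_inf [set e%:E | e in [set e : R | 0 <= e /\ within_distance X Y e]].

Definition lifted_point A (l : A -> R) (a : A) : 'rV[R]_(d + 1) :=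
  row_mx (val a) (const_mx (l a)).

Definition lifted_polytope A (l : A -> R) : set 'rV[R]_(d + 1) :=
  convex_hull (range (lifted_point l)).

Definition upper_facet (P F : set 'rV[R]_(d + 1)) : Prop :=
  facet P F /\
  exists u, outward_normal P F u /\ 0 < u 0 (rshift d (ord0 : 'I_1)).

Definition points_on A (l : A -> R) (F : set 'rV[R]_(d + 1)) :
    {fset 'rV[R]_d} :=
  [fset val a | a : A & `[< F (lifted_point l a) >]]%fset.

Definition generic_lifting A (l : A -> R) : Prop :=
  forall F, upper_facet (lifted_polytope l) F ->
    is_simplex d F /\ #|` points_on l F| = d.+1.

Definition is_regular_triangulation A (l : A -> R) T : Prop :=
  generic_lifting l /\
  forall B, B \in T <->
    exists2 F, upper_facet (lifted_polytope l) F & B = points_on l F.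

End Toric.

Arguments toric_variety {R d} A.
Arguments realization {R d} A T.

(* Main.v *)
(* An upper facet of the lifted polytope is the tight set of an affine function
   y.a + h >= log w_a. At x = exp(-y) the numbers w_a x^a attain their maximum
   exactly on the facet, so the largest coordinates of the corresponding point z
   of X_{A,w} are those indexed by the facet. A point p of |T| within less than
   1/(2(d+1)) of z is supported on a simplex B of T; it has a coordinate at least
   1/(d+1), so the largest coordinates of z exceed the distance and p cannot
   vanish there: the facet is contained in B, and equals B by cardinality.
   Conversely, the upper facets cover the convex hull of A (linear programming
   duality), so the barycenter of each B in T lies in some upper facet, which is
   a simplex of T and hence, by the face condition, is B itself. *)
Require Import Defs.
From HB Require Import structures.
From mathcomp Require Import all_boot all_order all_algebra.
From mathcomp Require Import finmap.
From mathcomp Require Import all_classical all_reals all_analysis.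
From mathcomp Require Import ring lra.
Import Order.TTheory GRing.Theory Num.Theory numFieldNormedType.Exports.
Local Open Scope classical_set_scope.
Local Open Scope ring_scope.
Set Implicit Arguments.
Unset Strict Implicit.
Unset Printing Implicit Defensive.

(** * Affine and convex combinations of finite families *)

Section Hulls.
Variables (R : realType) (V : lmodType R).
Implicit Types (S : set V).

Lemma affine_hull_sum S (I : finType) (x : I -> V) (c : I -> R) :
  (forall i, S (x i)) -> \sum_i c i = 1 ->
  affine_hull S (\sum_i c i *: x i).
Proof.
move=> Sx c1.
exists #|I|, (x \o @enum_val I I), (c \o @enum_val I I); split => /=.
- by move=> i; apply: Sx.
- by rewrite -c1 [RHS](reindex (@enum_val I I)) //; apply/onW_bij/enum_val_bij.
- by rewrite (reindex (@enum_val I I)) //; apply/onW_bij/enum_val_bij.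
Qed.

Lemma convex_hull_sum S (I : finType) (x : I -> V) (c : I -> R) :
  (forall i, S (x i)) -> (forall i, 0 <= c i) -> \sum_i c i = 1 ->
  convex_hull S (\sum_i c i *: x i).
Proof.
move=> Sx c0 c1.
exists #|I|, (x \o @enum_val I I), (c \o @enum_val I I); split => /=.
- by move=> i; apply: Sx.
- by move=> i; apply: c0.
- by rewrite -c1 [RHS](reindex (@enum_val I I)) //; apply/onW_bij/enum_val_bij.
- by rewrite (reindex (@enum_val I I)) //; apply/onW_bij/enum_val_bij.
Qed.

(** The definitions of the hulls allow a point to be repeated. Choosing an index for each point and
    adding up the coefficients with the same index gives a combination over [I] itself. *)
Lemma gather_coefficients (I : finType) (g : I -> V) {n} {x : 'I_n -> V}
    (c : 'I_n -> R) : (forall i, range g (x i)) ->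
  exists2 f : 'I_n -> I, \sum_i c i = \sum_j \sum_(i | f i == j) c i &
    \sum_i c i *: x i = \sum_j (\sum_(i | f i == j) c i) *: g j.
Proof.
move=> xg.
have /choice[f fE] : forall i, exists j, x i = g j.
  by move=> i; have [j _ <-] := xg i; exists j.
exists f; first by rewrite (partition_big f predT).
rewrite (partition_big f predT) //=; apply: eq_bigr => j _.
by rewrite scaler_suml; apply: eq_bigr => i /eqP <-; rewrite fE.
Qed.

Lemma affine_hull_range (I : finType) (g : I -> V) p :
  affine_hull (range g) p ->
  exists2 c : I -> R, \sum_i c i = 1 & p = \sum_i c i *: g i.
Proof.
move=> [n [x [c [xg c1 ->]]]].
have [f c1E pE] := gather_coefficients c xg.
by exists (fun j => \sum_(i | f i == j) c i); [rewrite -c1E | exact: pE].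
Qed.

Lemma convex_hull_range (I : finType) (g : I -> V) p :
  convex_hull (range g) p ->
  exists c : I -> R, [/\ forall i, 0 <= c i, \sum_i c i = 1
                       & p = \sum_i c i *: g i].
Proof.
move=> [n [x [c [xg c0 c1 ->]]]].
have [f c1E pE] := gather_coefficients c xg.
exists (fun j => \sum_(i | f i == j) c i); split; last exact: pE.
- by move=> j; apply: sumr_ge0 => i _; apply: c0.
- by rewrite -c1E.
Qed.

Lemma fset_range (B : {fset V}) : [set` B] = range (val : B -> V).
Proof.
apply/seteqP; split => [b /= bB|_ [b _ <-]] /=; last exact: valP.
by exists [` bB]%fset.
Qed.

Lemma sub_convex_hull S : S `<=` convex_hull S.
Proof.
move=> p Sp; exists 1%N, (fun=> p), (fun=> 1).
by split=> //; rewrite big_ord1 // scale1r.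
Qed.

Lemma convex_hull_sub_affine S : convex_hull S `<=` affine_hull S.
Proof. by move=> p [n [x [c [Sx _ c1 ->]]]]; exists n, x, c. Qed.

Lemma affine_hull_mono S S' : S `<=` S' -> affine_hull S `<=` affine_hull S'.
Proof.
by move=> SS' p [n [x [c [Sx c1 ->]]]]; exists n, x, c; split=> // i; apply: SS'.
Qed.

Lemma convex_hull_mono S S' : S `<=` S' -> convex_hull S `<=` convex_hull S'.
Proof.
move=> SS' p [n [x [c [Sx c0 c1 ->]]]]; exists n, x, c.
by split=> // i; apply: SS'.
Qed.

Lemma affine_hull_idem (I : finType) (g : I -> V) :
  affine_hull (affine_hull (range g)) `<=` affine_hull (range g).
Proof.
move=> p [n [x [c [Sx c1 ->]]]].
have /choice[k kP] : forall i, exists k : I -> R,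
    \sum_j k j = 1 /\ x i = \sum_j k j *: g j.
  by move=> i; have [k k1 xE] := affine_hull_range (Sx i); exists k.
have -> : \sum_i c i *: x i = \sum_j (\sum_i c i * k i j) *: g j.
  under [RHS]eq_bigr do rewrite scaler_suml.
  rewrite exchange_big; apply: eq_bigr => i _; rewrite (kP i).2 scaler_sumr.
  by apply: eq_bigr => j _; rewrite scalerA.
apply: affine_hull_sum => [i|]; first by exists i.
rewrite exchange_big -[RHS]c1; apply: eq_bigr => i _.
by rewrite -mulr_sumr (kP i).1 mulr1.
Qed.

End Hulls.

(** * Affine functions on R^n, spanning sets and affine dimension *)

Section AffineFunctions.
Variables (R : realType) (n : nat).
Local Notation V := 'rV[R]_n.
Implicit Types (u v p y : V) (h : R).

Definition aff y h p : R := dot y p + h.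

Lemma dotE u v : dot u v = (u *m v^T) 0 0.
Proof. by rewrite mxE; apply: eq_bigr => i _; rewrite mxE. Qed.

Lemma dotDl u v p : dot (u + v) p = dot u p + dot v p.
Proof. by rewrite !dotE mulmxDl mxE. Qed.

Lemma dotZl (t : R) u p : dot (t *: u) p = t * dot u p.
Proof. by rewrite !dotE -scalemxAl mxE. Qed.

Lemma dotNl u p : dot (- u) p = - dot u p.
Proof. by rewrite -scaleN1r dotZl mulN1r. Qed.

Lemma dot0r u : dot u 0 = 0.
Proof. by rewrite dotE trmx0 mulmx0 mxE. Qed.

Lemma dot_sum u (I : finType) (x : I -> V) (c : I -> R) :
  dot u (\sum_i c i *: x i) = \sum_i c i * dot u (x i).
Proof.
under [RHS]eq_bigr do rewrite mulr_sumr.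
rewrite exchange_big; apply: eq_bigr => j _ /=.
rewrite summxE mulr_sumr; apply: eq_bigr => i _.
by rewrite mxE mulrCA.
Qed.

Lemma aff_sum y h (I : finType) (x : I -> V) (c : I -> R) :
  \sum_i c i = 1 -> aff y h (\sum_i c i *: x i) = \sum_i c i * aff y h (x i).
Proof.
move=> c1; rewrite /aff dot_sum -[X in _ + X]mul1r -c1 mulr_suml -big_split.
by apply: eq_bigr => i _ /=; rewrite mulrDr.
Qed.

Lemma affD y h y' h' t p :
  aff (y + t *: y') (h + t * h') p = aff y h p + t * aff y' h' p.
Proof. by rewrite /aff dotDl dotZl; ring. Qed.

Lemma affN y h p : aff (- y) (- h) p = - aff y h p.
Proof. by rewrite /aff dotNl opprD. Qed.

Lemma affZ y h t p : aff (t *: y) (t * h) p = t * aff y h p.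
Proof. by rewrite /aff dotZl mulrDr. Qed.

Lemma aff0 p : aff 0 0 p = 0.
Proof. by rewrite -(scale0r 0) -[X in aff _ X](mul0r 0) affZ mul0r. Qed.

Lemma aff_eq0 y h : (forall p, aff y h p = 0) -> y = 0 /\ h = 0.
Proof.
move=> H; have h0 : h = 0 by have := H 0; rewrite /aff dot0r add0r.
split=> //; apply/rowP => i; have := H (delta_mx 0 i).
rewrite /aff h0 addr0 /dot (bigD1 i) //= big1 => [|j ji].
  by rewrite !mxE !eqxx mulr1 addr0.
by rewrite !mxE eqxx (negPf ji) mulr0.
Qed.

Lemma aff_hull_eq y h (S : set V) c :
  (forall p, S p -> aff y h p = c) ->
  forall p, affine_hull S p -> aff y h p = c.
Proof.
move=> H p [m [x [k [Sx k1 ->]]]]; rewrite aff_sum //.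
by rewrite -[RHS]mul1r -k1 mulr_suml; apply: eq_bigr => i _; rewrite H.
Qed.

Lemma aff_hull_le y h (S : set V) c :
  (forall p, S p -> aff y h p <= c) ->
  forall p, convex_hull S p -> aff y h p <= c.
Proof.
move=> H p [m [x [k [Sx k0 k1 ->]]]]; rewrite aff_sum //.
rewrite -[leRHS]mul1r -k1 mulr_suml; apply: ler_sum => i _.
by rewrite ler_wpM2l // H.
Qed.

Lemma aff_spanning_eq0 y h (S : set V) :
  affine_hull S = setT -> (forall p, S p -> aff y h p = 0) -> y = 0 /\ h = 0.
Proof.
by move=> ST H; apply: aff_eq0 => p; apply: (@aff_hull_eq y h S) => //; rewrite ST.
Qed.

(** Let [M] have the rows [(g, 1)]. If its rank is [n + 1], every [(p, 1)] is a combination of rows,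
    and the last column says that the coefficients sum to 1. Otherwise a nonzero vector killed by
    [M] is an affine function vanishing on [G]. *)
Lemma spanning_or_vanishing (G : {fset V}) :
  affine_hull [set` G] = setT \/
  exists y h, (y, h) <> (0, 0) /\ forall g, g \in G -> aff y h g = 0.
Proof.
pose M : 'M[R]_(#|{: G}|, n + 1) :=
  \matrix_i row_mx (val (enum_val i)) (const_mx 1).
have [/row_fullP[D DM]|nfull] := boolP (row_full M); [left|right].
  apply/seteqP; split => // p _.
  have E : row_mx p (const_mx 1) = row_mx p (const_mx 1) *m D *m M.
    by rewrite -mulmxA DM mulmx1.
  move: E; set k := _ *m D => E.
  have -> : p = \sum_i k 0 i *: val (enum_val i).
    have := congr1 lsubmx E; rewrite row_mxKl mulmx_sum_row linear_sum => -> /=.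
    by apply: eq_bigr => i _; rewrite linearZ /= rowK row_mxKl.
  apply: affine_hull_sum => [i|]; first exact: valP.
  have := congr1 rsubmx E; rewrite row_mxKr mulmx_sum_row linear_sum => /matrixP.
  move=> /(_ 0 0); rewrite mxE summxE => -> /=.
  by apply: eq_bigr => i _; rewrite linearZ /= rowK row_mxKr !mxE mulr1.
have : kermx M^T != 0 by rewrite kermx_eq0 /row_free mxrank_tr.
rewrite -nz_row_eq0; set v := nz_row _ => v0.
have vM : v *m M^T = 0 by apply/sub_kermxP; apply: nz_row_sub.
exists (lsubmx v), (rsubmx v 0 0); split.
  move=> [l0 r0]; move/eqP: v0; apply; rewrite -[LHS]hsubmxK l0.
  rewrite (_ : rsubmx v = 0) ?row_mx0 //.
  by apply/matrixP => i j; rewrite !ord1 r0 mxE.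
move=> g gG; have := congr1 (fun X : 'rV_ _ => X 0 (enum_rank [` gG]%fset)) vM.
rewrite [LHS]mxE [RHS]mxE big_split_ord /= => E; rewrite -[RHS]E; congr (_ + _).
  apply: eq_bigr => i _.
  by rewrite [M^T _ _]mxE [M _ _]mxE enum_rankK row_mxEl mxE.
by rewrite big_ord1 [M^T _ _]mxE [M _ _]mxE enum_rankK row_mxEr !mxE mulr1.
Qed.

(** For a fixed [b] in [G], the [#|G| - 1] differences [g - b] span a space that contains the
    direction space [U]. *)
Lemma affine_dim_card (G : {fset V}) k :
  affine_dim [set` G] k -> (k < #|` G|)%N.
Proof.
move=> [p [U [<- GU]]].
have Gp : affine_hull [set` G] p by rewrite GU /= subrr mem0v.
have [b bG] : exists b, b \in G.
  move: Gp => [[|m] [x [c [Sx c1 _]]]]; last by exists (x 0); apply: Sx.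
  by move: c1; rewrite big_ord0 => /eqP; rewrite eq_sym oner_eq0.
rewrite (cardfsD1 b) bG add1n ltnS.
pose X := [seq g - b | g <- (G `\ b)%fset].
have sX : size X = #|` (G `\ b)%fset| by rewrite size_map.
rewrite -sX; apply: leq_trans (dim_span X); apply: dimvS.
have HX q : affine_hull [set` G] q -> q - b \in <<X>>%VS.
  move=> [m [x [c [Sx c1 ->]]]].
  rewrite -[b in _ - b]scale1r -c1 scaler_suml -sumrB; apply: memv_suml => i _.
  rewrite -scalerBr; apply: memvZ; have [->|xb] := eqVneq (x i) b.
    by rewrite subrr mem0v.
  apply: memv_span; apply/mapP; exists (x i) => //.
  by rewrite !inE xb; apply: Sx.
apply/subvP => v vU.
have -> : v = (p + v - b) - (p - b) by rewrite opprB addrA subrK addrC addKr.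
by apply: memvB; apply: HX => //; rewrite GU /= addrC addKr.
Qed.

Lemma affine_dim_spanning (S : set V) : affine_hull S = setT -> affine_dim S n.
Proof.
move=> ST; exists 0, fullv; split; first by rewrite dimvf /dim /= mul1n.
by rewrite ST; apply/seteqP; split=> // q _ /=; rewrite memvf.
Qed.

Lemma spanning_affine_dim (S : set V) : affine_dim S n -> affine_hull S = setT.
Proof.
move=> [p [U [dU ->]]].
have -> : U = fullv.
  by apply/eqP; rewrite -(geq_leqif (dimv_leqif_eq (subvf U))) dimvf /dim /= mul1n dU.
by apply/seteqP; split=> // q _ /=; rewrite memvf.
Qed.

Lemma affine_dim_unique (S : set V) k :
  affine_hull S = setT -> affine_dim S k -> k = n.
Proof.
move=> ST [p [U [<-]]]; rewrite ST => TU.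
have -> : U = fullv.
  apply/vspaceP => v; rewrite memvf.
  have : [set: V] (p + v) by [].
  by rewrite TU /= addrC addKr.
by rewrite dimvf /dim /= mul1n.
Qed.

End AffineFunctions.

(** * Affine majorants of a lifting function and their contact sets *)

Section Majorants.
Variables (R : realType) (d : nat) (A : {fset 'rV[R]_d}) (l : A -> R).
Implicit Types (y : 'rV[R]_d) (h : R).

Definition majorant y h : Prop := forall a, l a <= aff y h (val a).

Definition tight y h : {fset 'rV[R]_d} :=
  [fset val a | a : A & l a == aff y h (val a)]%fset.

Lemma mem_tight y h (a : A) : (val a \in tight y h) = (l a == aff y h (val a)).
Proof.
apply/imfsetP/idP => [[b /= bt /val_inj ->]|at_]; first exact: bt.
by exists a.
Qed.

Lemma tight_sub y h : (tight y h `<=` A)%fset.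
Proof. by apply/fsubsetP => _ /imfsetP[a _ ->]; apply: valP. Qed.

Lemma tightP y h p : p \in tight y h ->
  exists2 a : A, val a = p & l a = aff y h (val a).
Proof. by move=> /imfsetP[a /= /eqP at_ ->]; exists a. Qed.

(** The ratio test of the simplex method: [t] is the least value of [(m a - l a) / - f a] over the
    points where [f] is negative, which is the largest step that keeps [m + t f] above [l]. It is
    positive because [m] exceeds [l] strictly at those points. *)
Lemma pivot (m f : A -> R) (b : A) :
  (forall a, l a <= m a) -> (forall a, l a = m a -> 0 <= f a) -> f b < 0 ->
  exists t, [/\ 0 < t, forall a, l a <= m a + t * f a
              & exists2 c, f c < 0 & l c = m c + t * f c].
Proof.
move=> lm f0 fb; pose r a := (m a - l a) / - f a.
case: (arg_minP r (P := [pred a | f a < 0]) fb) => c /= fc cmin.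
have rc : r c * f c = l c - m c by rewrite /r; field; rewrite lt_eqF.
exists (r c); split.
- rewrite divr_gt0 ?oppr_gt0// subr_gt0 lt_neqAle lm andbT.
  by apply/eqP => /f0; rewrite leNgt fc.
- move=> a; have [fa|fa] := ltP (f a) 0; last first.
    rewrite -[leLHS]addr0 lerD ?lm// mulr_ge0 // /r.
    by rewrite divr_ge0 ?subr_ge0 ?lm// oppr_ge0 ltW.
  have := cmin a fa; rewrite {2}/r ler_pdivlMr ?oppr_gt0//.
  by rewrite mulrN lerBrDr addrC lerBlDr addrC.
- by exists c => //; rewrite rc addrC subrK.
Qed.

(** While the tight set does not span, some nonzero affine function vanishes on it. Pivoting along
    that function keeps the old tight points and adds a new one, which can happen only finitely
    often. *)
Lemma spanning_majorant : affine_hull [set` A] = setT ->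
  exists y h, majorant y h /\ affine_hull [set` tight y h] = setT.
Proof.
move=> hA.
have H k : (exists y h, majorant y h /\ affine_hull [set` tight y h] = setT) \/
    exists y h, majorant y h /\ (k <= #|` tight y h|)%N.
  elim: k => [|k [|[y [h [maj kt]]]]]; last 2 first.
  - by left.
  - have [sp|[y' [h' [n0 van]]]] := spanning_or_vanishing (tight y h).
      by left; exists y, h.
    right.
    (* As [A] spans, the function is nonzero somewhere on [A]; a change of sign makes it negative
       there. *)
    wlog [b fb] : y' h' n0 van / exists b : A, aff y' h' (val b) < 0.
      move=> W; have [b fb] : exists b : A, aff y' h' (val b) != 0.
        apply: contrapT => /forallNP N; apply: n0.
        have [] // := aff_spanning_eq0 (y := y') (h := h') hA; last by move=> -> ->.
        move=> p /= pA; have := N [` pA]%fset.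
        by move=> /negP; rewrite negbK => /eqP.
      move: fb; rewrite neq_lt => /orP[fb|fb].
        by apply: (W y' h') => //; exists b.
      apply: (W (- y') (- h')).
      + move=> [/eqP + /eqP]; rewrite !oppr_eq0 => /eqP y0 /eqP h0.
        by apply: n0; rewrite y0 h0.
      + by move=> g /van; rewrite affN => ->; rewrite oppr0.
      + by exists b; rewrite affN oppr_lt0.
    have [|t [t0 maj' [c fc ct]]] :=
        pivot (f := fun a => aff y' h' (val a)) maj _ fb.
      by move=> a /eqP; rewrite -mem_tight => /van ->.
    exists (y + t *: y'), (h + t * h'); split.
      by move=> a; rewrite affD.
    apply: (leq_ltn_trans kt); apply: fproper_ltn_card; rewrite fproperE.
    apply/andP; split.
      apply/fsubsetP => p pt; have [a ap la] := tightP pt.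
      move: pt; rewrite -ap => pt.
      by rewrite mem_tight affD van // mulr0 addr0 la.
    apply/fsubsetPn; exists (val c); first by rewrite mem_tight affD ct.
    by apply/negP => /van c0; move: fc; rewrite c0 ltxx.
  (* The induction starts from a constant function that dominates all values of [l]. *)
  - right; exists 0, (\sum_a `|l a|); split => // a.
    rewrite /aff /dot big1 ?add0r => [|i _]; last by rewrite mxE mul0r.
    by rewrite (bigD1 a) //= (le_trans (ler_norm _)) // lerDl sumr_ge0.
have [//|[y [h [_]]]] := H #|` A|.+1.
by rewrite ltnNge (fsubset_leq_card (tight_sub y h)).
Qed.

End Majorants.

(** * Upper facets of the lifted polytope and majorants *)

Section Facets.
Variables (R : realType) (d : nat) (A : {fset 'rV[R]_d}) (l : A -> R).
Implicit Types (y : 'rV[R]_d) (h : R) (F : set 'rV[R]_(d + 1)).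

Local Notation lift := (lifted_point l).
Local Notation P := (lifted_polytope l).

Lemma dot_row_mx (u : 'rV[R]_d) (s : R) v (t : R) :
  dot (row_mx u (const_mx s) : 'rV_(d + 1)) (row_mx v (const_mx t)) =
  dot u v + s * t.
Proof.
rewrite /dot big_split_ord big_ord1 /=; congr (_ + _).
  by apply: eq_bigr => i _; rewrite !row_mxEl.
by rewrite !row_mxEr !mxE.
Qed.

Lemma row_mx_split (u : 'rV[R]_(d + 1)) :
  u = row_mx (lsubmx u) (const_mx (u 0 (rshift d ord0))).
Proof.
rewrite -[LHS]hsubmxK; congr row_mx.
by apply/matrixP => i j; rewrite !ord1 !mxE.
Qed.

Lemma lift_in_polytope (a : A) : P (lift a).
Proof. by apply: sub_convex_hull; exists a. Qed.

Lemma lift_inj : injective lift.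
Proof. by move=> a b /eq_row_mx[/val_inj]. Qed.

(** The vector [(-y, 1)] takes the value [l a - y.a] at the lifted point of [a]; it is at most [h],
    with equality exactly on the tight set. Since the tight set spans, the face cut out in this way
    has dimension [d]. *)
Lemma upper_facet_of_majorant y h :
  affine_hull P = setT -> majorant l y h ->
  affine_hull [set` tight l y h] = setT ->
  exists2 F, upper_facet P F & points_on l F = tight l y h.
Proof.
move=> hP maj sp.
pose u : 'rV[R]_(d + 1) := row_mx (- y) (const_mx 1).
have uE a : dot u (lift a) = l a - dot y (val a).
  by rewrite dot_row_mx dotNl mul1r addrC.
have uP p : P p -> aff u 0 p <= h.
  apply: aff_hull_le => _ [a _ <-]; rewrite /aff addr0 uE lerBlDl; exact: maj.
pose F := P `&` [set p | dot u p = h].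
have oF : outward_normal P F u.
  by exists h; split => // p /uP; rewrite /aff addr0.
exists F.
  split; last by exists u; split => //; rewrite row_mxEr mxE.
  split; first by exists u.
  exists d; split.
    by have := affine_dim_spanning hP; rewrite {2}addn1.
  (* [M] sends [v] to [(v, y.v)] and is injective, so [p0] plus its image is the graph of [aff y h],
     of dimension [d]. This graph is shown to be the affine hull of [F]. *)
  pose M : 'M[R]_(d, d + 1) := row_mx 1%:M y^T.
  pose p0 : 'rV[R]_(d + 1) := row_mx 0 (const_mx h).
  have ME v : v *m M = row_mx v (const_mx (dot y v)).
    rewrite mul_mx_row mulmx1; congr row_mx.
    apply/matrixP => i j; rewrite !ord1 !mxE.
    by apply: eq_bigr => k _; rewrite !mxE mulrC.
  exists p0, (limg (linfun (mulmxr M))); split.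
    rewrite limg_dim_eq; first by rewrite dimvf /dim /= mul1n.
    apply/eqP; rewrite -subv0; apply/subvP => v /memv_capP[_].
    rewrite memv_ker lfunE /= ME memv0 => /eqP E.
    by have := congr1 lsubmx E; rewrite row_mxKl linear0 => ->.
  apply/seteqP; split => q.
    move=> qF; have : aff u 0 q = h.
      by move: q qF; apply: aff_hull_eq => p [_ /=]; rewrite /aff addr0.
    rewrite /aff addr0 [q in dot u q]row_mx_split dot_row_mx dotNl mul1r => qh /=.
    have -> : q - p0 = lsubmx q *m M.
      rewrite ME {1}[q]row_mx_split /p0 opp_row_mx add_row_mx subr0.
      congr row_mx; apply/matrixP => i j; rewrite !mxE -qh.
      by rewrite opprD opprK addrCA subrr addr0.
    rewrite (_ : _ *m M = linfun (mulmxr M) (lsubmx q)); last by rewrite lfunE.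
    by rewrite memv_img ?memvf.
  move=> /memv_imgP[v _]; rewrite lfunE /= ME => /eqP.
  rewrite subr_eq /p0 add_row_mx addr0 => /eqP qE.
  (* If [v] is an affine combination of tight points, the point of the graph over [v] is the same
     combination of their lifts, which lie on [F]. *)
  have : [set: 'rV[R]_d] v by [].
  rewrite -sp fset_range => /affine_hull_range[c c1 vE].
  have -> : q = \sum_i c i *: row_mx (val i) (const_mx (aff y h (val i))).
    apply/rowP => j; rewrite qE summxE; case: (split_ordP j) => k ->.
      rewrite row_mxEl {1}vE summxE; apply: eq_bigr => i _.
      by rewrite [LHS]mxE [RHS]mxE row_mxEl.
    rewrite row_mxEr !mxE -[LHS]/(aff y h v) {1}vE aff_sum//.
    by apply: eq_bigr => i _; rewrite [RHS]mxE row_mxEr mxE.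
  apply: affine_hull_sum => // i.
  have [a ai la] := tightP (valP i); rewrite -ai -la.
  split; first exact: lift_in_polytope.
  by rewrite /= -/(lift a) uE la /aff addrC addKr.
apply/fsetP => b; apply/imfsetP/idP => [[a /= /asboolP[_ /=]] + ->|bt].
  by rewrite uE mem_tight => <-; rewrite /aff addrC subrK.
have [a ab la] := tightP bt; exists a => //=; apply/asboolP; split.
  exact: lift_in_polytope.
by rewrite /= uE la /aff addrC addKr.
Qed.

(** Dividing the supporting inequality by the positive last coordinate [s] of the normal vector and
    solving for the height turns it into an affine majorant. *)
Lemma majorant_of_upper_facet F : upper_facet P F ->
  exists y h, [/\ majorant l y h, points_on l F = tight l y h
    & F = convex_hull (lift @` [set a | l a = aff y h (val a)])].
Proof.
move=> [_ [u [[c [uP FE]] u0]]].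
set s := u 0 _ in u0.
pose y := - s^-1 *: lsubmx u; pose h := s^-1 * c.
have sn0 : s != 0 by rewrite gt_eqF.
have uE a : c - dot u (lift a) = s * (aff y h (val a) - l a).
  rewrite [u]row_mx_split dot_row_mx -/s /aff /y dotZl /h.
  by field.
have maj : majorant l y h.
  move=> a; have := uP _ (lift_in_polytope a).
  by rewrite -subr_ge0 uE pmulr_rge0// subr_ge0.
have eqE a : (dot u (lift a) = c) <-> l a = aff y h (val a).
  split=> [E|E]; apply/eqP.
    move: (uE a); rewrite E subrr => /esym/eqP; rewrite mulf_eq0 (negPf sn0) /=.
    by rewrite subr_eq0 eq_sym.
  by rewrite eq_sym -subr_eq0 uE E subrr mulr0.
exists y, h; split => //.
  apply/fsetP => b; apply/imfsetP/imfsetP => -[a /=].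
    move=> /asboolP; rewrite FE => -[_ /= /eqE la] ->.
    by exists a => //=; apply/eqP.
  move=> /eqP/eqE la ->; exists a => //=; apply/asboolP; rewrite FE.
  by split=> //; apply: lift_in_polytope.
rewrite FE; apply/seteqP; split => p; last first.
  move=> pH; split.
    by move: p pH; apply: convex_hull_mono => _ [a _ <-]; exists a.
  have : aff u 0 p = c.
    move: p pH => p /convex_hull_sub_affine; move: p; apply: aff_hull_eq.
    by move=> _ [a /= /eqE <- <-]; rewrite /aff addr0.
  by rewrite /aff addr0.
move=> [/convex_hull_range[k [k0 k1 pE]] /= uc].
(* Complementary slackness: the terms [k a * (c - dot u (lift a))] are non-negative and sum to 0, so
   each of them vanishes. *)
have k_tight a : k a != 0 -> l a = aff y h (val a).
  move=> ka; have : \sum_a k a * (c - dot u (lift a)) = 0.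
    under eq_bigr do rewrite mulrBr.
    by rewrite sumrB -mulr_suml k1 mul1r -dot_sum -pE uc subrr.
  move=> /psumr_eq0P E; apply: (proj1 (eqE a)); apply/eqP.
  rewrite eq_sym -subr_eq0; have F0 : k a * (c - dot u (lift a)) = 0.
    apply: E => // i _; rewrite mulr_ge0 // subr_ge0 uP //.
    exact: lift_in_polytope.
  by move/eqP: F0; rewrite mulf_eq0 (negPf ka).
have [a0 ka0] : exists a, k a != 0.
  apply: contrapT => /forallNP N; move/eqP: k1; rewrite big1 => [|a _].
    by rewrite eq_sym oner_eq0.
  by apply/eqP/negPn/negP/N.
(* Indices of weight zero are redirected to the tight point [a0], so that every point of the
   combination is a tight one. *)
have -> : p = \sum_a k a *: lift (if k a == 0 then a0 else a).
  rewrite pE; apply: eq_bigr => a _.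
  by case: ifP => // /eqP ->; rewrite !scale0r.
apply: convex_hull_sum => // a; exists (if k a == 0 then a0 else a) => //=.
by case: ifPn => [_|] /=; exact: k_tight.
Qed.

(** A facet of the full-dimensional [P] has dimension [d], and its affine hull is that of the lifted
    tight points. There must be more than [d] of them, and if there are exactly [d + 1], they are
    the vertices of a simplex. *)
Lemma upper_facet_simplex F : affine_hull P = setT -> upper_facet P F ->
  (d < #|` points_on l F|)%N /\
  (#|` points_on l F| = d.+1 -> is_simplex d F).
Proof.
move=> hP uF; have [y [h [_ pF FE]]] := majorant_of_upper_facet uF.
have [[_ [k [dP dF]]] _] := uF.
have kd : k = d by have := affine_dim_unique hP dP; rewrite addn1 => -[].
rewrite {}kd in dP dF.
pose B := [fset lift a | a : A & l a == aff y h (val a)]%fset.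
have BE : [set` B] = lift @` [set a | l a = aff y h (val a)].
  apply/seteqP; split => b /=.
    by move=> /imfsetP[a /= /eqP la ->]; exists a.
  by move=> [a la <-]; apply/imfsetP; exists a => //=; apply/eqP.
have cB : #|` B| = #|` points_on l F|.
  by rewrite pF /B /tight !card_imfset //; exact: lift_inj.
have dB : affine_dim [set` B] d.
  move: dF => [p [U [dU FU]]]; exists p, U; split => //; rewrite -FU FE -BE.
  apply/seteqP; split.
    by apply: affine_hull_mono; apply: sub_convex_hull.
  rewrite fset_range => q /(affine_hull_mono (@convex_hull_sub_affine _ _ _)).
  exact: affine_hull_idem.
split; first by rewrite -cB; apply: affine_dim_card.
by move=> cF; exists B; [split => //; rewrite cB | rewrite FE BE].
Qed.

End Facets.

(** * Barycentric coordinates, vertices and faces of simplices *)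

Section Simplices.
Variables (R : realType) (d : nat).
Implicit Types (B C : {fset 'rV[R]_d}).

(** The [d] points other than [b] are too few to span, so a nonzero affine function vanishes on
    them. It cannot vanish at [b], and is scaled to be 1 there. *)
Lemma barycentric_coordinate B b : affine_hull [set` B] = setT ->
  #|` B| = d.+1 -> b \in B ->
  exists y h, aff y h b = 1 /\ forall g, g \in B -> g != b -> aff y h g = 0.
Proof.
move=> sp cB bB.
have [/affine_dim_spanning/affine_dim_card|[y [h [n0 van]]]] :=
  spanning_or_vanishing (B `\ b)%fset.
  by have := cardfsD1 b B; rewrite bB cB add1n => -[<-]; rewrite ltnn.
have fb : aff y h b != 0.
  apply/eqP => fb; apply: n0.
  have [] // := aff_spanning_eq0 (y := y) (h := h) sp; last by move=> -> ->.
  move=> g /= gB; have [->//|gb] := eqVneq g b.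
  by apply: van; rewrite !inE gb.
exists ((aff y h b)^-1 *: y), ((aff y h b)^-1 * h).
split; first by rewrite affZ mulVf.
by move=> g gB gb; rewrite affZ (van g) ?mulr0 //; rewrite !inE gb.
Qed.

Lemma barycentric_sum B (b : B) y h (c : B -> R) : aff y h (val b) = 1 ->
  (forall g, g \in B -> g != val b -> aff y h g = 0) ->
  \sum_i c i = 1 -> aff y h (\sum_i c i *: val i) = c b.
Proof.
move=> fb f0 c1; rewrite aff_sum // (bigD1 b) //= fb mulr1 big1 ?addr0 // => i ib.
by rewrite f0 ?mulr0.
Qed.

(** On the common hull the barycentric coordinate of a vertex [b] is at most 1, with equality only
    at [b]. When [b] is written as a convex combination of [C], a point of [C] with nonzero weight
    must attain the value 1, hence is [b]. *)
Lemma simplex_vertices_sub B C : affine_hull [set` B] = setT ->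
  #|` B| = d.+1 -> convex_hull [set` B] = convex_hull [set` C] ->
  (B `<=` C)%fset.
Proof.
move=> sp cB BC; apply/fsubsetP => b bB.
have [y [h [fb f0]]] := barycentric_coordinate sp cB bB.
have f1 p : convex_hull [set` B] p -> aff y h p <= 1.
  apply: aff_hull_le => g /= gB; have [->|gb] := eqVneq g b; first by rewrite fb.
  by rewrite f0.
have f1b p : convex_hull [set` B] p -> aff y h p = 1 -> p = b.
  rewrite fset_range => /convex_hull_range[c [c0 c1 ->]].
  rewrite (barycentric_sum (b := [` bB]%fset)) // => cb.
  move: c1; rewrite (bigD1 [` bB]%fset) //= cb => /eqP.
  rewrite -[X in _ == X]addr0 (inj_eq (addrI 1)) => /eqP/psumr_eq0P E.
  rewrite (bigD1 [` bB]%fset) //= cb scale1r big1 ?addr0 // => i ib.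
  by rewrite E ?scale0r.
have : convex_hull [set` C] b by rewrite -BC; apply: sub_convex_hull.
rewrite {1}fset_range => /convex_hull_range[c [c0 c1 bE]].
have Cle i : aff y h (val (i : C)) <= 1.
  by apply: f1; rewrite BC; apply: sub_convex_hull; apply: valP.
have : \sum_i c i * (1 - aff y h (val i)) = 0.
  under eq_bigr do rewrite mulrBr mulr1.
  by rewrite sumrB c1 -aff_sum // -bE fb subrr.
move=> /psumr_eq0P E.
have [i ci] : exists i, c i != 0.
  apply: contrapT => /forallNP N; move/eqP: c1; rewrite big1 => [|a _].
    by rewrite eq_sym oner_eq0.
  by apply/eqP/negPn/negP/N.
have : c i * (1 - aff y h (val i)) = 0.
  by apply: E => // j _; rewrite mulr_ge0 // subr_ge0.
move/eqP; rewrite mulf_eq0 (negPf ci) subr_eq0 /= => /eqP/esym/f1b <-.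
  exact: valP.
by rewrite BC; apply: sub_convex_hull; apply: valP.
Qed.

Definition barycenter B : 'rV[R]_d := \sum_(b : B) (#|` B|%:R)^-1 *: val b.

Lemma barycenter_weights B : #|` B| = d.+1 ->
  \sum_(b : B) (#|` B|%:R)^-1 = 1 :> R.
Proof.
by move=> cB; rewrite sumr_const -cardfE -[LHS]mulr_natr mulVf // cB pnatr_eq0.
Qed.

Lemma barycenter_in_hull B : #|` B| = d.+1 ->
  convex_hull [set` B] (barycenter B).
Proof.
move=> cB; apply: convex_hull_sum => [b||]; [exact: valP| |exact: barycenter_weights].
by rewrite invr_ge0.
Qed.

(** All weights of the barycenter are positive, so equality in the supporting inequality there
    forces equality at every vertex. *)
Lemma hull_sub_face B F : #|` B| = d.+1 -> face (convex_hull [set` B]) F ->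
  F (barycenter B) -> convex_hull [set` B] `<=` F.
Proof.
move=> cB [u [c [uB ->]]] [_ /= ub] p pB; split => //.
have uc (b : B) : dot u (val b) = c.
  have : \sum_(b : B) (#|` B|%:R)^-1 * (c - dot u (val b)) = 0.
    under eq_bigr do rewrite mulrBr.
    by rewrite sumrB -mulr_suml barycenter_weights // mul1r -dot_sum ub subrr.
  move=> /psumr_eq0P E.
  have : (#|` B|%:R)^-1 * (c - dot u (val b)) = 0.
    apply: E => // i _; rewrite mulr_ge0 ?invr_ge0 // subr_ge0 uB //.
    by apply: sub_convex_hull; apply: valP.
  move/eqP; rewrite mulf_eq0 invr_eq0 cB pnatr_eq0 /= subr_eq0 => /eqP.
  by move=> ->.
have : aff u 0 p = c; last by rewrite /aff addr0.
apply: (aff_hull_eq _ (convex_hull_sub_affine pB)) => b /= bB.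
by rewrite /aff addr0 (uc [` bB]%fset).
Qed.

Lemma face_of_spanning B (S F : set 'rV[R]_d) : affine_hull [set` B] = setT ->
  face S F -> [set` B] `<=` F -> S `<=` F.
Proof.
move=> sp [u [c [uS ->]]] BF p Sp; split => //=.
have : aff u 0 p = c; last by rewrite /aff addr0.
apply: (@aff_hull_eq _ _ _ _ [set` B]); last by rewrite sp.
by move=> b /BF[_ /=]; rewrite /aff addr0.
Qed.

(** The common face contains the barycenter of [B], hence all of the first simplex. It then contains
    a spanning set, hence is all of the second simplex too, and two simplices with the same hull
    have the same vertices. *)
Lemma simplices_eq B C : spans_simplex d B -> spans_simplex d C ->
  let I := convex_hull [set` B] `&` convex_hull [set` C] in
  face (convex_hull [set` B]) I -> face (convex_hull [set` C]) I ->
  convex_hull [set` C] (barycenter B) -> B = C.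
Proof.
move=> [cB /spanning_affine_dim sB] [cC _] I IB IC Cb.
have BI : convex_hull [set` B] `<=` I.
  by apply: hull_sub_face => //; split => //; apply: barycenter_in_hull.
have CI : convex_hull [set` C] `<=` I.
  apply: (face_of_spanning sB IC) => b bB.
  by apply: BI; apply: sub_convex_hull.
apply/eqP; rewrite eqEfcard cC cB leqnn andbT; apply: simplex_vertices_sub => //.
by apply/seteqP; split => p; [move=> /BI[] | move=> /CI[]].
Qed.

End Simplices.

(** * Linear programming over the polyhedron of majorants *)

Section OptimalMajorant.
Variables (R : realType) (d : nat) (A : {fset 'rV[R]_d}) (l : A -> R).

(* A pair [(y, h)] encodes the affine function [aff y h]; these are the vertices
   of the polyhedron of affine majorants of [l]. *)
Definition vertex (v : 'rV[R]_d * R) : Prop :=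
  majorant l v.1 v.2 /\ affine_hull [set` tight l v.1 v.2] = setT.

Lemma vertex_inj v v' : vertex v -> vertex v' ->
  tight l v.1 v.2 = tight l v'.1 v'.2 -> v = v'.
Proof.
case: v v' => [y h] [y' h'] [_ /= sp] _ E.
have [p|/= yy hh] := aff_spanning_eq0 (y := y + (-1) *: y') (h := h + (-1) * h') sp.
  move=> pt; have [a ap la] := tightP pt.
  have : val a \in tight l y' h' by rewrite -E ap.
  by rewrite mem_tight affD -ap -la => /eqP <-; rewrite mulN1r subrr.
congr pair.
  by apply/eqP; rewrite -subr_eq0 -scaleN1r yy.
by apply/eqP; rewrite -subr_eq0 -mulN1r hh.
Qed.

(** A vertex is determined by its tight set, so the vertices are indexed by some of the subsets of
    [A], and a minimum over finitely many values exists. *)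
Lemma optimal_vertex b : affine_hull [set` A] = setT ->
  exists2 v, vertex v &
  forall v', vertex v' -> aff v.1 v.2 b <= aff v'.1 v'.2 b.
Proof.
move=> hA; pose G := fpowerset A.
pose Q (B : G) := [set v | vertex v /\ tight l v.1 v.2 = val B].
(* The default [(0, 0)] is never met: the minimum is taken over the [B] with [Q B] non-empty. *)
pose vtx (B : G) := xget (0, 0) (Q B).
have vE v : vertex v -> exists2 B, `[< Q B !=set0 >] & vtx B = v.
  move=> vv; have tG : tight l v.1 v.2 \in G by rewrite fpowersetE tight_sub.
  have Qv : Q [` tG]%fset v by [].
  exists [` tG]%fset; first by apply/asboolP; exists v.
  have [v'v t'] := xgetPex (0, 0) (ex_intro _ v Qv).
  by apply: vertex_inj => //; rewrite t'.
have [y0 [h0 v0]] := spanning_majorant l hA.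
have [B0 QB0 _] := vE (y0, h0) v0.
case: (arg_minP (fun B => aff (vtx B).1 (vtx B).2 b)
  (P := fun B => `[< Q B !=set0 >]) QB0) => B /asboolP[v Qv] Bmin.
have [vB _] := xgetPex (0, 0) (ex_intro _ v Qv).
by exists (vtx B) => // v' /vE[B' QB' <-]; apply: Bmin.
Qed.

(** The witness is the vertex whose value at [b] is least. A negative barycentric coordinate of [b]
    in its tight simplex would contradict this minimality. *)
Lemma hull_tight_cover b : affine_hull [set` A] = setT ->
  (forall v, vertex v -> #|` tight l v.1 v.2| = d.+1) ->
  convex_hull [set` A] b ->
  exists2 v, vertex v & convex_hull [set` tight l v.1 v.2] b.
Proof.
move=> hA card_tight Ab; have [v vv vmin] := optimal_vertex b hA.
exists v => //; have cv := card_tight _ vv.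
move: v vv vmin cv => [y h] /= vv vmin cv.
have [maj sp] := vv; rewrite /= in maj sp.
have : affine_hull [set` tight l y h] b by rewrite sp.
rewrite fset_range => /affine_hull_range[c c1 bE].
rewrite bE; apply: convex_hull_sum => // i.
rewrite leNgt; apply/negP => ci.
(* A pivot of the dual simplex method: adding a positive multiple of the
   barycentric coordinate of [i], which is negative at [b], reaches a vertex
   with a smaller value at [b]. *)
have [y' [h' [fi f0]]] := barycentric_coordinate sp cv (valP i).
have fb : aff y' h' b < 0 by rewrite bE (barycentric_sum (b := i)).
have [a fa] : exists a : A, aff y' h' (val a) < 0.
  apply: contrapT => /forallNP N; move: fb; rewrite ltNge => /negP; apply.
  rewrite -oppr_le0 -affN; apply: aff_hull_le Ab => p /= pA.
  by rewrite affN oppr_le0 leNgt; apply/negP; apply: (N [` pA]%fset).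
have [|t [t0 maj' [k fk kt]]] :=
  pivot (f := fun a => aff y' h' (val a)) maj _ fa.
  move=> g /eqP; rewrite -mem_tight => gt.
  by have [->|gi] := eqVneq (val g) (val i); [rewrite fi | rewrite f0].
(* In the tight set, [i] is exchanged for [k]. A function vanishing on the new tight set, with value
   [r] at [i], agrees with [r] times the coordinate of [i] on the old tight set, hence everywhere.
   As that coordinate is nonzero at [k], [r] is 0. *)
have vn : vertex (y + t *: y', h + t * h').
  split => /=; first by move=> g; rewrite affD.
  have [//|[y2 [h2 [n0 van]]]] :=
    spanning_or_vanishing (tight l (y + t *: y') (h + t * h')).
  case: n0; pose r := aff y2 h2 (val i).
  have [p|/= yy hh] := aff_spanning_eq0 (y := y2 + (- r) *: y') (h := h2 + (- r) * h') sp.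
    move=> pt; rewrite affD; have [->|pi] := eqVneq p (val i).
      by rewrite fi mulr1 subrr.
    rewrite f0 // mulr0 addr0; apply: van.
    have [g gp lg] := tightP pt; rewrite -gp mem_tight affD gp f0 // mulr0 addr0.
    by rewrite -gp lg.
  have r0 : r = 0.
    have : aff (y2 + (- r) *: y') (h2 + (- r) * h') (val k) = 0.
      by rewrite yy hh aff0.
    rewrite affD van ?mem_tight ?affD -?kt// add0r mulNr => /eqP.
    by rewrite oppr_eq0 mulf_eq0 (lt_eqF fk) orbF => /eqP.
  by move: yy hh; rewrite r0 oppr0 scale0r mul0r !addr0 => -> ->.
have := vmin _ vn; rewrite /= affD leNgt => /negP; apply.
by rewrite gtrDl pmulr_rlt0.
Qed.

End OptimalMajorant.

(** * Extremal points of the translated toric variety and nearby points of the realization *)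

Section ToricPoints.
Variables (R : realType) (d : nat) (A : {fset 'rV[R]_d}).
Implicit Types (y : 'rV[R]_d) (h : R) (w p : A -> R).

Lemma monomial_exp y (a : 'rV[R]_d) :
  monomial (\row_i expR (y 0 i)) a = expR (dot y a).
Proof.
rewrite /monomial /dot (big_morph (@expR R) (@expRD R) (@expR0 R)).
by apply: eq_bigr => i _; rewrite mxE -expRM.
Qed.

(** Both normalizations multiply all coordinates by one non-negative factor, so it suffices to
    compare the numbers [exp (ln (w c) - y.c)]. *)
Lemma toric_point_of_majorant w y h : (forall a, 0 < w a) ->
  majorant (fun a => ln (w a)) y h ->
  exists2 z, toric_translate w z &
    forall a b, val a \in tight (fun a => ln (w a)) y h -> z b <= z a.
Proof.
move=> w0 maj; pose x : 'rV[R]_d := \row_i expR ((- y) 0 i).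
exists (weight_act w (toric_map x)).
  exists (toric_map x) => //; apply: subset_closure; exists x => // i.
  by rewrite mxE expR_gt0.
move=> a b; rewrite mem_tight => /eqP la.
have tm0 c : 0 <= toric_map x c :> R.
  rewrite /toric_map /normalize mulr_ge0 ?invr_ge0 ?sumr_ge0 // => [i _|];
  by rewrite monomial_exp expR_ge0.
rewrite /weight_act /normalize ler_wpM2l ?invr_ge0 ?sumr_ge0 // => [i _|].
  by rewrite mulr_ge0 // ltW.
rewrite /toric_map /normalize mulrCA [leRHS]mulrCA ler_wpM2l //.
  by rewrite invr_ge0 sumr_ge0 // => i _; rewrite monomial_exp expR_ge0.
have E c : w c * monomial x (val c) = expR (ln (w c) - dot y (val c)).
  by rewrite monomial_exp dotNl expRD lnK // posrE.
by rewrite !E ler_expR; move: (maj b) la; rewrite /aff /=; lra.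
Qed.

Lemma realization_point (B : {fset 'rV[R]_d}) p :
  convex_hull (@basis_vector R d A @` [set a : A | val a \in B]) p ->
  (forall a, val a \notin B -> p a = 0) /\
  \sum_(a | val a \in B) p a = 1.
Proof.
move=> [n [x [c [Bx _ c1 ->]]]].
have E a : (\sum_i c i *: x i) a = \sum_i c i * x i a by rewrite fct_sumE.
split=> [a aB|].
  rewrite E big1 // => i _; have [b /= bB <-] := Bx i.
  rewrite /basis_vector; have [ab|_] := eqVneq a b; last by rewrite mulr0.
  by rewrite ab bB in aB.
under eq_bigr do rewrite E.
rewrite exchange_big -[RHS]c1; apply: eq_bigr => i _.
rewrite -mulr_sumr; have [b /= bB <-] := Bx i.
rewrite (bigD1 b) //= big1 => [|a /andP[_ /negPf ab]].
  by rewrite /basis_vector eqxx addr0 mulr1.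
by rewrite /basis_vector ab.
Qed.

Lemma coordinate_le_norm (z : A -> R) a : `|z a| <= euclidean_norm z.
Proof.
rewrite /euclidean_norm -sqrtr_sqr ler_wsqrtr // (bigD1 a) //= lerDl.
by apply: sumr_ge0 => i _; apply: sqr_ge0.
Qed.

Lemma card_preimage_val (B : {fset 'rV[R]_d}) :
  (#|[pred a : A | val a \in B]| <= #|` B|)%N.
Proof.
rewrite cardE -(size_map val); apply: uniq_leq_size.
  by rewrite map_inj_uniq ?enum_uniq //; exact: val_inj.
by move=> b /mapP[a]; rewrite mem_enum => aB ->.
Qed.

(* If all coordinates of [z] were at most [e < 1/(2(d+1))], the coordinates on
   [B] of the nearby [p] would be at most [2 e] and could not sum to 1. Hence
   the largest coordinates of [z] exceed [e], and [p] does not vanish there. *)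
Lemma large_coordinates (B : {fset 'rV[R]_d}) (z p : A -> R) (e : R) a :
  #|` B| = d.+1 -> 0 <= e -> e < (2 * d.+1%:R)^-1 ->
  convex_hull (@basis_vector R d A @` [set a : A | val a \in B]) p ->
  euclidean_norm (z - p) <= e -> (forall b, z b <= z a) -> val a \in B.
Proof.
move=> cB e0 elt /realization_point[p0 p1] zp zmax.
have zpE b : `|z b - p b| <= e.
  exact: (le_trans (coordinate_le_norm (z - p) b) zp).
apply/negPn/negP => /p0 pa.
have za : z a <= e.
  by have := zpE a; rewrite pa subr0; apply: le_trans; apply: ler_norm.
have : \sum_(b : A | val b \in B) p b <= \sum_(b : A | val b \in B) (2 * e).
  apply: ler_sum => b _; have := zpE b; rewrite ler_norml => /andP[H _].
  by have := zmax b; lra.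
rewrite p1 sumr_const -[_ *+ _]mulr_natr leNgt => /negP; apply.
apply: (@le_lt_trans _ _ (2 * e * d.+1%:R)).
  by rewrite ler_wpM2l ?mulr_ge0 // ler_nat -cB card_preimage_val.
by rewrite -mulrA mulrC -mulrA -ltr_pdivlMr ?mulr_gt0 // mul1r mulrC.
Qed.

End ToricPoints.

(** * Identification of the triangulation with the collection of upper facets *)

Unset Implicit Arguments.

Theorem theorem4p8 (R : realType) (d : nat) (A : {fset 'rV[R]_d})
  (hA : affine_hull [set` A] = setT)
  (T : {fset {fset 'rV[R]_d}}) (hT : triangulation A T)
  (w : A -> R) (hw : forall a, 0 < w a)
  (hP : affine_hull (lifted_polytope (fun a => ln (w a))) = setT)
  (hdist : (hausdorff_distance (toric_translate w) (realization A T)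
            < ((2 * d.+1%:R)^-1)%:E)%E) :
  is_regular_triangulation (fun a => ln (w a)) T.
Proof.
set l := fun a => ln (w a) in hP *.
have [TA Tcov Tface] := hT.
(* As the infimum is below the bound, so is some admissible distance [e]; [XT] supplies a point of
   the realization within [e] of each point of the variety. *)
have [_ [e [e0 [XT _]] <-] elt] := ereal_inf_lt hdist.
rewrite lte_fin in elt.
have tightT y h : majorant l y h -> (d < #|` tight l y h|)%N ->
    tight l y h \in T.
  move=> maj dt; have [z zX zmax] := toric_point_of_majorant hw maj.
  have [p [B /= BT Bp] zp] := XT z zX.
  have [_ [cB _]] := TA B BT.
  suff -> : tight l y h = B by [].
  apply/eqP; rewrite eqEfcard cB dt andbT; apply/fsubsetP => b bt.
  have [a ab _] := tightP bt; rewrite -ab.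
  apply: (large_coordinates cB e0 elt Bp zp) => c; apply: zmax.
  by rewrite ab.
have facetT F : upper_facet (lifted_polytope l) F -> points_on l F \in T.
  move=> uF; have [dF _] := upper_facet_simplex hP uF.
  have [y [h [maj pF _]]] := majorant_of_upper_facet uF.
  by move: dF; rewrite pF; apply: tightT.
split.
  move=> F uF; have [_ [cF _]] := TA _ (facetT F uF).
  by split => //; apply: (upper_facet_simplex hP uF).2.
move=> B; split=> [BT|[F uF ->]]; last exact: facetT.
have [BA [cB dB]] := TA B BT.
(* A spanning tight set has more than [d] points, so it belongs to [T] and has exactly [d + 1], as
   the covering argument requires. *)
have vertexT v : vertex l v -> tight l v.1 v.2 \in T.
  move=> [maj sp]; apply: tightT => //.
  exact: affine_dim_card (affine_dim_spanning sp).
have [v vv Cb] : exists2 v, vertex l v &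
    convex_hull [set` tight l v.1 v.2] (barycenter B).
  apply: (hull_tight_cover hA) => [v vv|]; first exact: (TA _ (vertexT v vv)).2.1.
  apply: (convex_hull_mono (S := [set` B])); last exact: barycenter_in_hull.
  by move=> b /= /(fsubsetP BA).
have CT := vertexT v vv.
have [|FB FC] := Tface B _ BT CT.
  by exists (barycenter B); split => //; apply: barycenter_in_hull.
have BC := simplices_eq (TA B BT).2 (TA _ CT).2 FB FC Cb.
have [F uF FE] := upper_facet_of_majorant hP vv.1 vv.2.
by exists F => //; rewrite FE.
Qed.
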